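(* For every integer $d\ge 1$ there are constants $c_d,C_d>0$ and an integer $N_d\ge 1$, depending only on $d$, such that every integer $n\ge N_d$ satisfies $$c_d\, n^{2d/(d+1)} \le \tau([n]^d) \le C_d\, n^{2d/(d+1)}.$$ Equivalently, for every fixed $d\ge 1$, $\tau([n]^d)=\Theta\left(n^{2d/(d+1)}\right)$ as $n\to\infty$, with implied constants depending only on $d$.
   Context: For a positive integer $n$, $[n]^d=\{1,\ldots,n\}^d\subset\mathbb{R}^d$ denotes the $d$-dimensional integer grid (a discrete set of $n^d$ points). For a finite set $Y\subset\mathbb{R}^d$, $\operatorname{ext}(Y)$ denotes the set of vertices (extreme points) of the convex hull $\operatorname{conv}(Y)$. Given a finite set $X\subset\mathbb{R}^d$, define $X_0=X$ and recursively $X_i=X_{i-1}\setminus\operatorname{ext}(X_{i-1})$ for $i\ge 1$. The layer number $\tau(X)$ is the smallest $i$ for which $X_i=\varnothing$. *)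

(* Defs.v *)
(* R^d is 'rV[R]_d with R : realType; convex_lmodType is the identity alias that
   carries the segment operation a <| t |> b = t *: a + (1 - t) *: b. *)
From HB Require Import structures.
From mathcomp Require Import all_boot all_order all_algebra.
From mathcomp Require Import boolp classical_sets reals interval_inference convex exp.

Set Implicit Arguments.
Unset Strict Implicit.
Unset Printing Implicit Defensive.

Import Order.TTheory GRing.Theory Num.Theory.

Local Open Scope classical_set_scope.
Local Open Scope ring_scope.
Local Open Scope convex_scope.

Definition convex_hull (R : realType) (d : nat)
    (Y : set (convex_lmodType 'rV[R]_d)) : set (convex_lmodType 'rV[R]_d) :=
  smallest (@convex_set R 'rV[R]_d) Y.

Definition extreme_points (R : realType) (d : nat)
    (K : set (convex_lmodType 'rV[R]_d)) : set (convex_lmodType 'rV[R]_d) :=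
  [set x | K x /\
    forall (a b : convex_lmodType 'rV[R]_d) (t : {i01 R}),
      K a -> K b -> 0 < t%:num < 1 -> x = a <| t |> b -> a = x /\ b = x].

Definition ext (R : realType) (d : nat) (Y : set (convex_lmodType 'rV[R]_d)) :
    set (convex_lmodType 'rV[R]_d) :=
  extreme_points (convex_hull Y).

Definition peel (R : realType) (d : nat) (Y : set (convex_lmodType 'rV[R]_d)) :
    set (convex_lmodType 'rV[R]_d) :=
  Y `\` ext Y.

Definition layer (R : realType) (d : nat) (X : set (convex_lmodType 'rV[R]_d))
    (i : nat) : set (convex_lmodType 'rV[R]_d) :=
  iter i (@peel R d) X.

(* The value is 0 by convention when no layer is empty; this does not occur
   for finite X, since a nonempty finite set contains a vertex of its hull. *)
Definition tau (R : realType) (d : nat) (X : set (convex_lmodType 'rV[R]_d)) :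
    nat :=
  xget 0%N [set i | layer X i = set0 /\
                    forall j : nat, layer X j = set0 -> (i <= j)%N].

Definition grid (R : realType) (d n : nat) : set (convex_lmodType 'rV[R]_d) :=
  [set x : 'rV[R]_d | forall j : 'I_d,
    exists2 k : nat, (1 <= k <= n)%N & x ord0 j = k%:R].
Arguments grid : clear implicits.

(* Main.v *)
Require Import Defs.
From mathcomp Require Import classical_sets reals interval_inference convex exp.
From mathcomp Require Import all_boot all_order all_algebra.
From mathcomp Require Import boolp zify ring lra.

Set Implicit Arguments.
Unset Strict Implicit.
Unset Printing Implicit Defensive.

Import Order.TTheory GRing.Theory Num.Theory.

(** Write d = D + 1, and let q be the least integer with n <= q^(d+1), so
    that n^(2d/(d+1)) is q^(2d), or n^2 / q^2, up to constants.

    Lower bound.  Peeling cannot eat a ball quickly.  If the current layer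
    contains all lattice points of the ball of squared radius r centred at a
    lattice point, and z is a lattice point of the ball of squared radius
    r - 9 d q^2, then the pigeonhole principle ([short_flat_vector]) gives a
    nonzero integer vector w which is short and almost orthogonal to z, so that
    z + w and z - w both stay in the larger ball.  Being their midpoint, z is not
    a vertex.  One step thus costs at most 9 d q^2 in squared radius
    ([layer_ball]), and about n^2 / q^2 steps are needed.

    Upper bound.  Fix a finite family of integer directions u with coordinates
    of size O(q^D), and follow the sum over u of the maxima of u . x over the
    current layer; it starts at O(n q^D) per direction.  If the maximum of
    u . x is attained at a single point, this point is a vertex, it is removed,
    and the integer maximum drops by at least 1.  It suffices that, whatever the
    layer is, a fixed proportion of the directions has a unique maximizer
    ([direction_family]): then O(n q^D) = O(q^(2d)) steps empty the grid.

    The directions are rational approximations u / u0 of the points a / S of a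
    cubic grid in dimension D, where S is of order q^(D+1) = q^d.  Dirichlet's
    theorem gives u0 of size O(q^D) and an error O(1/S) for most a, and for most
    a no nonzero integer vector of size E, with E of order q, is orthogonal to
    (u0, u); both are union bounds ([card_good_directions]).  For such a
    direction, a face of a lattice polytope with two lattice points has an
    extent greater than E.  But few directions can have so long a face: if
    x is in the face of direction a / S, then the map x |-> a is, up to O(1), the
    normal map of a convex body, which is monotone, so x / q + a determines a up
    to a bounded error ([monotone_separation]).  The long faces, translated by
    a, are therefore almost disjoint segments in a box with O(S^D) cells, each
    segment meeting J cells with J a large constant ([card_long_faces]). *)

(** * Counting solutions of congruences *)

Lemma pigeonhole (T : finType) (m : nat) (f : T -> nat) :
  (forall x, f x < m) -> m < #|T| -> exists x y, x != y /\ f x = f y.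
Proof.
move=> fm mT; pose g x := Ordinal (fm x).
have: ~~ injectiveb g.
  by apply/injectiveP => /leq_card; rewrite card_ord leqNgt mT.
by move=> /injectivePn[x [y xy [e]]]; exists x, y.
Qed.

(** While a runs over [0, S), the value k a + c goes round the circle of length
    S at most k + 1 times, and each time at most T / k + 1 of its terms, which
    are k apart, fall in the window [0, T]. *)
Lemma card_progression (S k c T : nat) : 0 < k ->
  #|[set a : 'I_S | (k * a + c) %% S <= T]| <= 2 * T + 2 * k.
Proof.
move=> k0; case: S => [|S]; first by rewrite cardsE (leq_trans (max_card _)) ?card_ord.
set A := [set _ | _].
have memA (a : 'I_S.+1) : a \in A -> (k * a + c %% S.+1) %% S.+1 <= T.
  by rewrite inE modnDmr.
set c' := c %% S.+1 in memA.
have c'S : c' < S.+1 by rewrite ltn_mod.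
pose f (a : 'I_S.+1) : 'I_k.+1 * 'I_(T %/ k).+1 :=
  (inord ((k * a + c') %/ S.+1), inord (((k * a + c') %% S.+1) %/ k)).
have fI : {in A &, injective f}.
  move=> a b /memA Aa /memA Ab [/(congr1 val)/= + /(congr1 val)/=].
  have div_lt (x : 'I_S.+1) : (k * x + c') %/ S.+1 < k.+1.
    rewrite ltn_divLR //; have := ltn_ord x; move: (nat_of_ord x) c'S; nia.
  rewrite !inordK ?div_lt ?ltnS ?leq_div2r // => e1 e2.
  have ea := divn_eq (k * a + c') S.+1; have eb := divn_eq (k * b + c') S.+1.
  have ra := divn_eq ((k * a + c') %% S.+1) k.
  have rb := divn_eq ((k * b + c') %% S.+1) k.
  have la := ltn_pmod ((k * a + c') %% S.+1) k0.
  have lb := ltn_pmod ((k * b + c') %% S.+1) k0.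
  apply/val_inj => /=; rewrite e1 in ea; rewrite e2 in ra.
  case: (ltngtP a b) => // ab; nia.
rewrite -(card_in_imset fI) (leq_trans (max_card _)) // card_prod !card_ord.
have := leq_divM T k; move: (T %/ k) => t; nia.
Qed.

(** A bound on every line parallel to the i-th axis gives a bound on the density
    of the set.  The factor S is on the left so that no predecessor of D
    appears. *)
Lemma card_fiberwise (D S N : nat) (i : 'I_D) (A : {set {ffun 'I_D -> 'I_S}}) :
  (forall a : {ffun 'I_D -> 'I_S},
     #|[set t | [ffun j => if j == i then t else a j] \in A]| <= N) ->
  #|A| * S <= N * S ^ D.
Proof.
move=> AN; pose upd (a : {ffun 'I_D -> 'I_S}) t := [ffun j => if j == i then t else a j].
pose B := [set p : {ffun 'I_D -> 'I_S} * 'I_S | upd p.1 p.2 \in A].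
pose f (p : {ffun 'I_D -> 'I_S} * 'I_S) := (upd p.1 p.2, p.1 i).
have fK p : upd (f p).1 (f p).2 = p.1.
  by apply/ffunP => j; rewrite !ffunE; case: eqP => // ->.
have fI : injective f.
  move=> p p' e; have := fK p; rewrite e fK => e1.
  move: e => [/ffunP/(_ i)]; rewrite !ffunE eqxx => e2 _.
  by case: p p' e1 e2 => [? ?] [? ?] /= -> ->.
have -> : #|A| * S = #|f @: (setX A [set: 'I_S])|.
  by rewrite card_imset // cardsX cardsT card_ord.
apply: (@leq_trans #|B|).
  apply: subset_leq_card; apply/subsetP => _ /imsetP[p pA ->].
  by rewrite inE fK; move: pA; rewrite inE => /andP[].
rewrite -sum1_card.
rewrite (eq_bigl (fun p => upd p.1 p.2 \in A)); last by move=> p; rewrite inE.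
rewrite -(pair_big_dep xpredT (fun a t => upd a t \in A) (fun _ _ => 1)) /=.
rewrite mulnC -[S in S ^ D]card_ord -[D in _ ^ D]card_ord -card_ffun -sum_nat_const.
apply: leq_sum => a _; rewrite sum1dep_card; exact: AN.
Qed.

Lemma modn_le_congr (S x v : nat) (w : int) :
  (x%:Z = v%:Z + S%:Z * w)%R -> x %% S <= v.
Proof.
move=> e; have : Posz (x %% S) = Posz (v %% S).
  by rewrite -!modz_nat e addrC mulrC modzMDl.
by move=> [->]; apply: leq_mod.
Qed.

Definition near_multiple (S T : nat) (x : int) : Prop :=
  exists z : int, (`|x + S%:Z * z| <= T%:Z)%R.

Lemma card_near_multiple (S T : nat) (k c : int) : k != 0%R ->
  #|[set t : 'I_S | `[< near_multiple S T (k * t%:Z + c)%R >]]| <= 4 * T + 2 * `|k|.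
Proof.
move=> k0; set A := [set _ | _].
have [S0|S0] := posnP S.
  by rewrite (leq_trans (max_card _)) // card_ord S0.
(* The sign of k is absorbed in c, and the window [-T, T] shifted to [0, 2T]. *)
pose c' := (Num.sg k * c + T%:Z)%R; pose m := `|(c' %% S)%Z|%N.
have mE : Posz m = (c' %% S)%Z by rewrite gez0_abs // modz_ge0 // -lt0n.
apply: (@leq_trans #|[set t : 'I_S | (`|k| * t + m) %% S <= 2 * T]|); last first.
  by rewrite (leq_trans (card_progression _ _ _ _)) ?absz_gt0 // mulnA.
apply/subset_leq_card/subsetP => t; rewrite !inE => /asboolP[z tz].
have kk : (`|k|%N%:Z = Num.sg k * k)%R by rewrite abszE; case: sgrP k0; lia.
pose v := (Num.sg k * (k * t%:Z + c + S%:Z * z) + T%:Z)%R.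
have v0 : (0 <= v <= 2 * T%:Z)%R.
  by move: tz; rewrite /v; move: (_ + _ + _)%R => y; case: sgrP k0; lia.
apply: (@leq_trans `|v|%N); last by lia.
apply: (@modn_le_congr _ _ _ (- (Num.sg k * z) - (c' %/ S)%Z)%R).
have := divz_eq c' S; rewrite -mE PoszD PoszM kk gez0_abs; last by case/andP: v0.
rewrite /v {1}/c' => /(canRL (addKr _)) ->; ring.
Qed.

Lemma card_linear_form (D S E T : nat) (e : 'I_D -> int) :
  (exists i, e i != 0%R) -> (forall i, `|e i| <= E) ->
  #|[set a : {ffun 'I_D -> 'I_S} |
      `[< near_multiple S T (\sum_i e i * (a i)%:Z)%R >]]| * S
    <= (4 * T + 2 * E) * S ^ D.
Proof.
move=> [i ei0] eE; apply: (@card_fiberwise _ _ _ i) => a.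
have := @card_near_multiple S T (e i) (\sum_(j | j != i) e j * (a j)%:Z)%R ei0.
have le2 : 4 * T + 2 * `|e i| <= 4 * T + 2 * E by rewrite leq_add2l leq_mul2l eE.
move=> le1; apply: leq_trans (leq_trans le1 le2).
apply/subset_leq_card/subsetP => t; rewrite !inE => /asboolP h; apply/asboolP.
move: h; rewrite (bigD1 i) //= ffunE eqxx; congr (near_multiple _ _ (_ + _)%R).
by apply: eq_bigr => j /negPf ji; rewrite ffunE ji.
Qed.

(** * Rational directions without short normals *)

Lemma leq_expn2r (m n k : nat) : m <= n -> m ^ k <= n ^ k.
Proof. by case: k => // k mn; rewrite leq_exp2r. Qed.

(** The union bound, with a weight s to match [card_fiberwise]. *)
Lemma card_exists_le (I T : finType) (P : I -> pred T) (s N : nat) :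
  (forall i, #|[set a | P i a]| * s <= N) ->
  #|[set a | [exists i, P i a]]| * s <= #|I| * N.
Proof.
move=> PN; rewrite -[leqRHS]sum_nat_const.
apply: (@leq_trans (\sum_(i in I) #|[set a | P i a]| * s)); last exact: leq_sum.
rewrite -big_distrl leq_mul2r /=; apply/orP; right.
rewrite (eq_bigr (fun i => \sum_a (P i a : nat))); last first.
  by move=> i _; rewrite -sum1dep_card big_mkcond.
rewrite exchange_big -sum1dep_card big_mkcond /=; apply: leq_sum => a _.
by case: existsP => // -[i Pia]; rewrite (bigD1 i) //= Pia.
Qed.

(** Among the multiples k a with 0 <= k <= Q^D, two have their residues modulo
    Q R in the same box of side R; u0 is the difference of their multipliers and
    u that of the quotients. *)
Lemma dirichlet (D Q R : nat) (a : 'I_D -> nat) : 0 < Q -> 0 < R ->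
  (forall i, a i < Q * R) ->
  exists u0 (u : 'I_D -> nat), [/\ 0 < u0 <= Q ^ D, forall i, u i <= u0 &
    forall i, (`|u0%:Z * (a i)%:Z - (Q * R)%N%:Z * (u i)%:Z| <= R%:Z)%R].
Proof.
move=> Q0 R0 aS; set S := (Q * R)%N in aS *.
have S0 : 0 < S by rewrite muln_gt0 Q0.
have cell k i : (k * a i) %% S %/ R < Q by rewrite ltn_divLR // ltn_mod.
pose f (k : 'I_(Q ^ D).+1) := [ffun i => Ordinal (cell k i)].
have [k [k' [kk' ff]]] : exists k k' : 'I_(Q ^ D).+1, k < k' /\ f k = f k'.
  have: ~~ injectiveb f.
    apply/injectiveP => /leq_card; rewrite card_ffun !card_ord; lia.
  move=> /injectivePn[x [y xy e]].
  by case: (ltngtP x y) xy => [|| /val_inj ->]; [exists x, y | exists y, x | rewrite eqxx].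
exists (k' - k), (fun i => k' * a i %/ S - k * a i %/ S); split.
- by have := ltn_ord k'; lia.
- move=> i; have le1 : k' * a i <= (k' - k) * S + k * a i.
    have := leq_mul (leqnn (k' - k)) (ltnW (aS i)); rewrite mulnBl.
    by have := leq_mul (ltnW kk') (leqnn (a i)); lia.
  by rewrite leq_subLR addnC -divnMDl // leq_div2r.
- move=> i; have := congr1 (fun g : {ffun 'I_D -> 'I_Q} => val (g i)) ff.
  rewrite !ffunE /= => e.
  have mono : k * a i %/ S <= k' * a i %/ S by rewrite leq_div2r // leq_mul2r ltnW ?orbT.
  have ek := divn_eq (k * a i) S; have ek' := divn_eq (k' * a i) S.
  have r := divn_eq ((k * a i) %% S) R; have r' := divn_eq ((k' * a i) %% S) R.
  have l := ltn_pmod ((k * a i) %% S) R0; have l' := ltn_pmod ((k' * a i) %% S) R0.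
  rewrite e in r.
  rewrite -!subzn //; last exact: ltnW.
  have -> : ((k'%:Z - k%:Z) * (a i)%:Z - S%:Z * ((k' * a i %/ S)%N%:Z - (k * a i %/ S)%N%:Z)
     = ((k' * a i) %% S)%N%:Z - ((k * a i) %% S)%N%:Z)%R.
    have := congr1 Posz ek; have := congr1 Posz ek'; rewrite !PoszD !PoszM.
    by rewrite mulrBl => -> ->; ring.
  lia.
Qed.

(** The integer vector (u0, u) stands for the direction (1, u / u0), which
    approximates (1, a / S) within B / S in each coordinate.  As u0 > 0,
    [good_normal] leaves no nonzero integer vector orthogonal to it whose last D
    coordinates have size at most E. *)
Record good_direction (D S B E : nat)
    (a : 'I_D -> nat) (u0 : nat) (u : 'I_D -> nat) : Prop := {
  good_gt0 : 0 < u0;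
  good_le : forall i, u i <= u0;
  good_close : forall i, (`|u0%:Z * (a i)%:Z - S%:Z * (u i)%:Z| <= B%:Z * u0%:Z)%R;
  good_normal : forall (e0 : int) (e : 'I_D -> int),
    (e0 * u0%:Z + \sum_i e i * (u i)%:Z = 0)%R ->
    (forall i, `|e i| <= E) -> forall i, e i = 0%R }.

(** If e is orthogonal to (u0, u), then replacing u / u0 by the nearby a / S moves
    the scalar product by at most D E B / S: a short normal of the approximation
    is an approximate integer relation between the coordinates of a / S. *)
Lemma close_normal (D S B E : nat)
    (a : 'I_D -> nat) (u0 : nat) (u : 'I_D -> nat) (e0 : int) (e : 'I_D -> int) : 0 < u0 ->
  (forall i, (`|u0%:Z * (a i)%:Z - S%:Z * (u i)%:Z| <= B%:Z * u0%:Z)%R) ->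
  (e0 * u0%:Z + \sum_i e i * (u i)%:Z = 0)%R ->
  (forall i, `|e i| <= E) ->
  near_multiple S (D * E * B) (\sum_i e i * (a i)%:Z)%R.
Proof.
move=> u0p close orth eE; exists e0.
rewrite -(@ler_pM2l _ u0%:Z) // -[X in (X * _)%R]gtr0_norm // -normrM.
have -> : (u0%:Z * (\sum_i e i * (a i)%:Z + S%:Z * e0) =
    \sum_i e i * (u0%:Z * (a i)%:Z - S%:Z * (u i)%:Z))%R.
  have -> : (u0%:Z * (\sum_i e i * (a i)%:Z + S%:Z * e0) =
      u0%:Z * (\sum_i e i * (a i)%:Z)
      + S%:Z * (e0 * u0%:Z + \sum_i e i * (u i)%:Z)
      - S%:Z * (\sum_i e i * (u i)%:Z))%R by ring.
  rewrite orth mulr0 addr0 !big_distrr -sumrB /=; apply: eq_bigr => i _; ring.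
apply: le_trans (ler_norm_sum _ _ _) _.
have -> : (u0%:Z * (D * E * B)%N%:Z = \sum_(i < D) E%:Z * (B%:Z * u0%:Z))%R.
  by rewrite sumr_const card_ord -mulr_natr natz !PoszM; ring.
apply: ler_sum => i _; rewrite normrM; apply: ler_pM => //.
by have := eE i; lia.
Qed.

(** Two kinds of points a are excluded, each at most a quarter of the total: in
    A1 those with an approximate integer relation of size E, which could produce
    a short normal, and in A2 those approximated within the Dirichlet bound by a
    denominator at most Q^D / B, for which the error on the fraction itself is
    too large.  The constant B makes A2 small, and B1, the ratio of
    Q to E, makes A1 small. *)
Lemma card_good_directions (D E : nat) :
  let B := 4 * 6 ^ D in let B1 := 4 * 3 ^ D * (4 * (D * B) + 2) in
  let Q := B1 * E in let S := Q ^ D.+1 in 0 < E ->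
  S ^ D <= 2 * #|[set a : {ffun 'I_D -> 'I_S} | `[< exists u0 u,
    u0 <= Q ^ D /\ good_direction S B E (fun i => nat_of_ord (a i)) u0 u >]]|.
Proof.
move=> B B1 Q S E0; set G := [set _ | _].
have B0 : 0 < B by rewrite muln_gt0 expn_gt0.
have B10 : 0 < B1 by rewrite !muln_gt0 expn_gt0 addn_gt0 orbT.
have Q0 : 0 < Q by rewrite muln_gt0 B10.
have S0 : 0 < S by rewrite expn_gt0 Q0.
set R := Q ^ D; have R0 : 0 < R by rewrite expn_gt0 Q0.
have SQR : S = Q * R by rewrite /S expnS.
(* The integer vectors of sup-norm at most E are coded by their shift by E. *)
pose P1 (e : {ffun 'I_D -> 'I_(2 * E).+1}) (a : {ffun 'I_D -> 'I_S}) :=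
  [exists i, (e i)%:Z - E%:Z != 0]%R &&
  `[< near_multiple S (D * E * B) (\sum_i ((e i)%:Z - E%:Z) * (a i)%:Z)%R >].
pose P2 (k : 'I_(R %/ B)) (a : {ffun 'I_D -> 'I_S}) :=
  [forall i, `[< near_multiple S R (k.+1%:Z * (a i)%:Z)%R >]].
pose A1 := [set a | [exists e, P1 e a]]; pose A2 := [set a | [exists e, P2 e a]].
have cover : ~: G \subset A1 :|: A2.
  apply/subsetP => a; rewrite inE inE; apply: contraR; rewrite inE negb_or => /andP[nA1 nA2].
  have [u0 [u [/andP[u00 u0R] uu0 close]]] :=
    @dirichlet D Q R (fun i => nat_of_ord (a i)) Q0 R0
      (fun i => leq_trans (ltn_ord (a i)) (eq_leq SQR)).
  rewrite -SQR in close.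
  have RB : R <= B * u0.
    rewrite leqNgt; apply: contra nA2 => lt; rewrite inE; apply/existsP.
    have ku : u0.-1 < R %/ B by rewrite leq_divRL // prednK // mulnC ltnW.
    exists (Ordinal ku); apply/forallP => i; apply/asboolP.
    exists (- (u i)%:Z)%R; rewrite mulrN /= prednK //.
  have close' i : (`|u0%:Z * (a i)%:Z - S%:Z * (u i)%:Z| <= B%:Z * u0%:Z)%R.
    by apply: le_trans (close i) _; lia.
  apply/asboolP; exists u0, u; split=> //; split=> // e0 e orth eE i.
  apply/eqP; apply: contraR nA1 => ei; rewrite inE; apply/existsP.
  have eb j : `|(e j + E%:Z)%R| < (2 * E).+1 by have := eE j; lia.
  exists [ffun j => Ordinal (eb j)].
  have eK j :
      ((([ffun j => Ordinal (eb j)] : {ffun 'I_D -> 'I_(2 * E).+1}) j)%:Z - E%:Z = e j)%R.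
    by rewrite ffunE /=; have := eE j; lia.
  apply/andP; split; first by apply/existsP; exists i; rewrite eK.
  apply/asboolP; under eq_bigr do rewrite eK.
  exact: close_normal close' orth eE.
have cA1 : 4 * #|A1| <= S ^ D.
  have : #|A1| * S <= #|{ffun 'I_D -> 'I_(2 * E).+1}| * ((4 * (D * E * B) + 2 * E) * S ^ D).
    apply: card_exists_le => e; rewrite /P1.
    case: existsP => [ex|_]; last first.
      by rewrite (_ : [set _ | _] = set0) ?cards0 //; apply/setP => x; rewrite !inE.
    apply: (@card_linear_form D S E (D * E * B) (fun i => (e i)%:Z - E%:Z)%R) => // i.
    by have := ltn_ord (e i); lia.
  rewrite card_ffun !card_ord => le1.
  rewrite -(leq_pmul2r S0) -mulnA.
  apply: leq_trans (leq_mul (leqnn 4) le1) _.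
  have le2 : (2 * E).+1 ^ D <= 3 ^ D * E ^ D by rewrite -expnMn leq_expn2r //; lia.
  rewrite [leqRHS]mulnC !mulnA leq_mul2r; apply/orP; right.
  apply: (@leq_trans (B1 * E ^ D.+1)).
    rewrite expnS /B1; move: le2; nia.
  by rewrite /S /Q expnMn leq_mul2r -[leqLHS]expn1 leq_pexp2l ?orbT.
have cA2 : 4 * #|A2| <= S ^ D.
  have : #|A2| * 1 <= #|'I_(R %/ B)| * (6 * R) ^ D.
    apply: card_exists_le => k; rewrite muln1.
    pose W := [set t : 'I_S | `[< near_multiple S R (k.+1%:Z * t%:Z + 0)%R >]].
    have -> : [set a | P2 k a] = [set a in ffun_on (mem W)].
      apply/setP => a; rewrite !inE; apply: eq_forallb => i.
      by rewrite inE addr0.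
    rewrite cardsE card_ffun_on card_ord leq_expn2r //.
    apply: leq_trans (card_near_multiple _ _ _ _) _ => //.
    have := leq_trans (ltn_ord k) (leq_div R B); lia.
  rewrite muln1 card_ord => le1.
  apply: leq_trans (leq_mul (leqnn 4) le1) _.
  have -> : S ^ D = R * R ^ D by rewrite /S /R -expnM mulnC expnM -expnS.
  rewrite expnMn; have := leq_divM R B; rewrite /B; nia.
have := leq_trans (subset_leq_card cover) (leq_card_setU A1 A2).1.
have := cardsC G; rewrite card_ffun !card_ord; lia.
Qed.

(** * Monotonicity of normals *)

Section Separation.
Local Open Scope ring_scope.
(** Here w is the difference of two points of a convex body, de the difference
    of normals to the body at them, so that w . de is nonnegative, and al an
    approximation of de.  If w + G al is at most G, then w is - G de up to O(G), and
    monotonicity leaves G |de|^2 <= O(G |de|): the normals differ by a bounded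
    amount. *)
Lemma monotone_separation (F : realFieldType) (D : nat) (G B : F)
    (w al de : 'I_D -> F) : 0 < G -> 0 <= B ->
  0 <= \sum_i w i * de i -> (forall i, `|w i + G * al i| <= G) ->
  (forall i, `|de i - al i| <= B) -> forall i, `|al i| <= D%:R * (1 + B) + B.
Proof.
move=> G0 B0 mono hw hd i; set c := 1 + B.
have c0 : 0 < c by rewrite /c; lra.
have term j : w j * de j <= G * (c * `|de j| - `|de j| ^+ 2).
  have -> : w j * de j =
      (w j + G * al j) * de j + G * (de j - al j) * de j - G * `|de j| ^+ 2.
    by rewrite -normrX ger0_norm ?sqr_ge0 //; ring.
  have h1 : (w j + G * al j) * de j <= G * `|de j|.
    by apply: le_trans (ler_norm _) _; rewrite normrM ler_wpM2r.
  have h2 : G * (de j - al j) * de j <= G * (B * `|de j|).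
    rewrite -mulrA ler_pM2l //.
    by apply: le_trans (ler_norm _) _; rewrite normrM ler_wpM2r.
  rewrite /c; lra.
have sum0 : 0 <= \sum_j (c * `|de j| - `|de j| ^+ 2).
  rewrite -(pmulr_rge0 _ G0) big_distrr /=.
  by apply: le_trans mono _; apply: ler_sum => j _; apply: term.
have others : \sum_(j | j != i) (c * `|de j| - `|de j| ^+ 2) <= D.-1%:R * c ^+ 2.
  have -> : D.-1%:R * c ^+ 2 = \sum_(j < D | j != i) c ^+ 2.
    rewrite sumr_const mulr_natl; congr (_ *+ _).
    by have := cardC1 i; rewrite card_ord => <-; apply: eq_card => j.
  apply: ler_sum => j _; nra.
rewrite (bigD1 i) //= in sum0.
have D0 : (0 < D)%N by apply: leq_ltn_trans (ltn_ord i).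
have DE : (D%:R = D.-1%:R + 1 :> F) by rewrite -[in LHS](prednK D0) -natr1.
have dei : `|de i| <= D%:R * c.
  rewrite leNgt; apply/negP => lt; rewrite DE in lt.
  have p0 : 0 <= D.-1%:R :> F by [].
  move: p0 lt others sum0; set p := D.-1%:R; set t := `|de i|.
  set s := \sum_(j | _) _ => p0 lt os sm.
  (* t > (p + 1) c would give t (t - c) > p c^2. *)
  have pc : 0 <= p * c by rewrite mulr_ge0 // ltW.
  have h1 : p * c < t - c by lra.
  have h2 : c * (p * c) <= c * (t - c) by rewrite ler_pM2l // ltW.
  have h3 : 0 < (t - c) * (t - c) by rewrite mulr_gt0 //; lra.
  nra.
have -> : al i = de i - (de i - al i) by ring.
apply: le_trans (ler_normB _ _) _; exact: lerD.
Qed.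
End Separation.

(** If (y0, y) and (y0', y') maximize the directions of a and a' against each
    other, and y / E + a and y' / E + a' agree up to rounding, then a and a' are
    at bounded distance.  The zeroth coordinate disappears on normalizing the
    directions to (1, u / u0). *)
Lemma good_separated (D S B E : nat) (a a' : 'I_D -> nat) (u0 u0' : nat)
    (u u' : 'I_D -> nat) (y0 y0' : nat) (y y' : 'I_D -> nat) : 0 < E ->
  good_direction S B E a u0 u -> good_direction S B E a' u0' u' ->
  u0 * y0' + \sum_i u i * y' i <= u0 * y0 + \sum_i u i * y i ->
  u0' * y0 + \sum_i u' i * y i <= u0' * y0' + \sum_i u' i * y' i ->
  (forall i, y i %/ E + a i = y' i %/ E + a' i) ->
  forall i, a i <= a' i + (D * (1 + 2 * B) + 2 * B).
Proof.
move=> E0 [u00 _ close _] [u00' _ close' _] le1 le2 floor i.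
pose w i := ((y i)%:R - (y' i)%:R : rat)%R.
pose al i := ((a i)%:R - (a' i)%:R : rat)%R.
pose th := (fun i => S%:R * (u i)%:R / u0%:R : rat)%R.
pose th' := (fun i => S%:R * (u' i)%:R / u0'%:R : rat)%R.
have dist (b v : 'I_D -> nat) (k : nat) : 0 < k ->
    (forall i, (`|k%:Z * (b i)%:Z - S%:Z * (v i)%:Z| <= B%:Z * k%:Z)%R) ->
    forall j, (`|S%:R * (v j)%:R / k%:R - (b j)%:R| <= B%:R :> rat)%R.
  move=> p cl j; have p' : (0 < k%:R :> rat)%R by rewrite ltr0n.
  rewrite -(ler_pM2r p') -{2}(gtr0_norm p') -normrM mulrBl divfK ?gt_eqF //.
  have := cl j; rewrite -(ler_int rat) intr_norm !rmorphB !rmorphM /= -!pmulrn => h.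
  by rewrite distrC [((b j)%:R * _)%R]mulrC.
(* Each inequality of maximality is divided by u0 (or u0') and multiplied by S. *)
have half (v : 'I_D -> nat) (k x0 x0' : nat) (x x' : 'I_D -> nat) : 0 < k ->
    k * x0' + \sum_i v i * x' i <= k * x0 + \sum_i v i * x i ->
    (0 <= S%:R * (x0%:R - x0'%:R) +
       \sum_i ((x i)%:R - (x' i)%:R) * (S%:R * (v i)%:R / k%:R) :> rat)%R.
  move=> p; have p' : (0 < k%:R :> rat)%R by rewrite ltr0n.
  rewrite -(ler_nat rat) !natrD !natrM !natr_sum -subr_ge0 => h.
  have -> : (S%:R * (x0%:R - x0'%:R) +
      \sum_i ((x i)%:R - (x' i)%:R) * (S%:R * (v i)%:R / k%:R) =
      S%:R / k%:R * (k%:R * x0%:R + \sum_i (v i * x i)%N%:R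
        - (k%:R * x0'%:R + \sum_i (v i * x' i)%N%:R)) :> rat)%R.
    rewrite [in RHS]opprD [in RHS]addrACA -[in RHS]sumrB -[in RHS]mulrBr.
    rewrite [in RHS]mulrDr mulrA divfK ?gt_eqF //; congr (_ + _)%R.
    by rewrite big_distrr /=; apply: eq_bigr => j _; rewrite !natrM; ring.
  by rewrite mulr_ge0 // divr_ge0.
have fin : (`|al i| <= D%:R * (1 + (2 * B)%:R) + (2 * B)%:R)%R.
  apply: (@monotone_separation rat D E%:R _ w al (fun j => th j - th' j)%R).
  - by rewrite ltr0n.
  - by [].
  - have := addr_ge0 (half _ _ _ _ _ _ u00 le1) (half _ _ _ _ _ _ u00' le2).
    rewrite addrACA -mulrDr -opprB addNr mulr0 add0r -big_split /=.
    by under eq_bigr do rewrite -[X in (_ + X * _)%R]opprB mulNr -mulrBr.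
  - move=> j; have e := congr1 (fun n => n%:R : rat)%R (floor j).
    have ey := congr1 (fun n => n%:R : rat)%R (divn_eq (y j) E).
    have ey' := congr1 (fun n => n%:R : rat)%R (divn_eq (y' j) E).
    have -> : (w j + E%:R * al j = ((y j) %% E)%:R - ((y' j) %% E)%:R)%R.
      rewrite /w /al ey ey' !natrD !natrM.
      by move: e; rewrite !natrD => /(canRL (addrK _)) ->; ring.
    have l : (((y j) %% E)%:R <= E%:R :> rat)%R by rewrite ler_nat ltnW ?ltn_mod.
    have l' : (((y' j) %% E)%:R <= E%:R :> rat)%R by rewrite ler_nat ltnW ?ltn_mod.
    have z : (0 <= ((y j) %% E)%:R :> rat)%R by [].
    have z' : (0 <= ((y' j) %% E)%:R :> rat)%R by [].
    rewrite ler_norml; lra.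
  - move=> j; rewrite /al.
    have := dist _ _ _ u00 close j; have := dist _ _ _ u00' close' j.
    rewrite -/(th j) -/(th' j) natrM !ler_norml; lra.
have bound : ((D * (1 + 2 * B) + 2 * B)%N%:R
    = D%:R * (1 + (2 * B)%:R) + (2 * B)%:R :> rat)%R by rewrite natrD natrM natrD.
rewrite -(ler_nat rat) natrD bound -lerBlDl.
by apply: le_trans fin; apply: ler_norm.
Qed.

(** * Directions with a long face *)

Definition cons_dir (D u0 : nat) (u : 'I_D -> nat) : 'I_D.+1 -> nat :=
  fun i => if unlift ord0 i is Some j then u j else u0.

Definition dot (d : nat) (v x : 'I_d -> nat) : nat := \sum_i v i * x i.

Lemma dot_cons (D u0 : nat) (u : 'I_D -> nat) (x : 'I_D.+1 -> nat) :
  dot (cons_dir u0 u) x = u0 * x ord0 + \sum_i u i * x (lift ord0 i).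
Proof.
rewrite /dot big_ord_recl /cons_dir unlift_none; congr (_ + _).
by apply: eq_bigr => i _; rewrite liftK.
Qed.

Definition coords (d n : nat) (x : {ffun 'I_d -> 'I_n.+1}) : 'I_d -> nat :=
  fun i => nat_of_ord (x i).

Definition face (d n : nat) (v : 'I_d -> nat) (X : {set {ffun 'I_d -> 'I_n.+1}}) :=
  [set x in X | [forall y in X, dot v (coords y) <= dot v (coords x)]].

(** J times the point at fraction j / J of the segment from x to y; the factor J
    keeps the coordinates integral. *)
Definition mix (d J j : nat) (x y : 'I_d -> nat) : 'I_d -> nat :=
  fun i => (J - j) * x i + j * y i.

Lemma dot_mix (d J j : nat) (v x y : 'I_d -> nat) :
  dot v (mix J j x y) = (J - j) * dot v x + j * dot v y.
Proof.
rewrite /dot /mix !big_distrr -big_split /=; apply: eq_bigr => i _; ring.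
Qed.

Lemma face_mix_max (d n J j j' : nat) (v : 'I_d -> nat)
    (X : {set {ffun 'I_d -> 'I_n.+1}}) (x y x' y' : {ffun 'I_d -> 'I_n.+1}) :
  j <= J -> j' <= J -> x \in face v X -> y \in face v X -> x' \in X -> y' \in X ->
  dot v (mix J j' (coords x') (coords y')) <= dot v (mix J j (coords x) (coords y)).
Proof.
move=> jJ j'J; rewrite !inE => /andP[xX /forall_inP mx] /andP[_ /forall_inP my] X' Y'.
rewrite !dot_mix.
apply: (@leq_trans ((J - j') * dot v (coords x) + j' * dot v (coords x))).
  by rewrite leq_add // leq_mul2l mx ?orbT.
apply: (@leq_trans ((J - j) * dot v (coords x) + j * dot v (coords x))).
  by rewrite -!mulnDl !subnK.
by rewrite leq_add2l leq_mul2l my ?orbT.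
Qed.

Lemma Posz_sum (I : finType) (f : I -> nat) :
  (Posz (\sum_i f i) = \sum_i (f i)%:Z)%R.
Proof.
by rewrite -natz natr_sum; under eq_bigr do rewrite natz.
Qed.

(** Two points of the face differ by a vector orthogonal to the direction, and
    [good_normal] forbids this difference to be small. *)
Lemma long_face (D n S B E u0 : nat) (a u : 'I_D -> nat)
    (X : {set {ffun 'I_D.+1 -> 'I_n.+1}}) :
  good_direction S B E a u0 u -> 1 < #|face (cons_dir u0 u) X| ->
  exists x y (i : 'I_D), [/\ x \in face (cons_dir u0 u) X, y \in face (cons_dir u0 u) X &
    coords x (lift ord0 i) + E < coords y (lift ord0 i)].
Proof.
move=> [u00 _ _ normal] /card_gt1P[x [y [xF yF xy]]].
have eqdot : dot (cons_dir u0 u) (coords x) = dot (cons_dir u0 u) (coords y).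
  move: xF yF; rewrite !inE => /andP[xX /forall_inP mx] /andP[yX /forall_inP my].
  by apply/eqP; rewrite eqn_leq mx ?my.
pose e (i : 'I_D) : int := ((coords x (lift ord0 i))%:Z - (coords y (lift ord0 i))%:Z)%R.
have [long|short] := pselect (exists i : 'I_D, E < `|e i|).
  have [i ei] := long.
  have [lt|ge] := ltnP (coords x (lift ord0 i)) (coords y (lift ord0 i)).
    by exists x, y, i; split=> //; move: ei; rewrite /e; lia.
  by exists y, x, i; split=> //; move: ei; rewrite /e; lia.
case/eqP: xy; have e0 : forall i, e i = 0%R.
  apply: (normal ((coords x ord0)%:Z - (coords y ord0)%:Z)%R); last first.
    by move=> i; rewrite leqNgt; apply/negP => lt; apply: short; exists i.
  move: eqdot; rewrite !dot_cons => /(congr1 Posz).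
  rewrite !PoszD !PoszM !Posz_sum => h.
  have -> : (\sum_i e i * (u i)%:Z = (\sum_(i < D) (u i * coords x (lift ord0 i))%:Z)
     - (\sum_(i < D) (u i * coords y (lift ord0 i))%:Z))%R.
    by rewrite -sumrB; apply: eq_bigr => i _; rewrite /e !PoszM; ring.
  by move/eqP: h; rewrite -subr_eq0 => /eqP h; apply: etrans h; ring.
have eqS i : coords x (lift ord0 i) = coords y (lift ord0 i).
  by have := e0 i; rewrite /e; lia.
have eq0 : coords x ord0 = coords y ord0.
  move: eqdot; rewrite !dot_cons; under eq_bigr do rewrite eqS.
  by move/addIn/eqP; rewrite eqn_pmul2l // => /eqP.
apply/ffunP => i; apply: val_inj.
by case: (unliftP ord0 i) => [j|] ->; [apply: eqS | apply: eq0].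
Qed.

Lemma modn_inj_near (K p q : nat) :
  p %% K = q %% K -> p < q + K -> q < p + K -> p = q.
Proof.
wlog le : p q / p <= q => [H e l l'|e _ lt].
  by case/orP: (leq_total p q) => le; [exact: H | apply/esym/H].
have : K %| q - p by rewrite -eqn_mod_dvd // e.
have [|pos] := posnP (q - p); first by lia.
by move/(dvdn_leq pos); lia.
Qed.

(** Each direction a with a long face contributes J points spread along a segment
    [x, y] of that face, and the j-th one goes to its cell of side E, translated
    by a.  The cell determines a up to a bounded error, hence determines a
    together with the residue of a modulo K; and since the segment advances by
    more than one cell at each step, it then determines j.  So the number of long
    faces, times J, is at most the number of pairs of a cell and a residue. *)
Lemma card_long_faces (D n S B E J : nat) (G : {set {ffun 'I_D -> 'I_S}})
    (u0 : {ffun 'I_D -> 'I_S} -> nat) (u : {ffun 'I_D -> 'I_S} -> 'I_D -> nat)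
    (X : {set {ffun 'I_D.+1 -> 'I_n.+1}}) :
  0 < E -> J * n <= S * E ->
  (forall a, a \in G -> good_direction S B E (fun i => nat_of_ord (a i)) (u0 a) (u a)) ->
  #|[set a in G | 1 < #|face (cons_dir (u0 a) (u a)) X|]| * J
    <= ((2 * S).+1 * (D * (1 + 2 * B) + 2 * B).+1) ^ D.
Proof.
move=> E0 JnSE good; set Bad := [set _ in G | _]; set K := (D * (1 + 2 * B) + 2 * B).+1.
pose pt := {ffun 'I_D.+1 -> 'I_n.+1}.
pose P a (xy : pt * pt) := a \in Bad -> exists i : 'I_D,
  [/\ xy.1 \in face (cons_dir (u0 a) (u a)) X, xy.2 \in face (cons_dir (u0 a) (u a)) X &
    coords xy.1 (lift ord0 i) + E < coords xy.2 (lift ord0 i)].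
have [f fP] : {f & forall a, P a (f a)}.
  apply: choice => a; have [aBad|nBad] := boolP (a \in Bad); last first.
    by exists ([ffun=> ord0], [ffun=> ord0]); rewrite /P (negPf nBad).
  move: (aBad); rewrite inE => /andP[aG big].
  have [x [y [i xyi]]] := long_face (good a aG) big.
  by exists (x, y) => _; exists i.
pose Y (p : {ffun 'I_D -> 'I_S} * 'I_J) := mix J p.2 (coords (f p.1).1) (coords (f p.1).2).
pose c (p : {ffun 'I_D -> 'I_S} * 'I_J) i := Y p (lift ord0 i) %/ E + p.1 i.
have cb p i : c p i < (2 * S).+1.
  have : Y p (lift ord0 i) <= J * n.
    rewrite /Y /mix -[X in _ <= X * n](subnK (ltnW (ltn_ord p.2))) mulnDl.
    by rewrite leq_add // leq_mul2l -ltnS ltn_ord orbT.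
  move=> /leq_trans/(_ JnSE)/(leq_div2r E); rewrite mulnK // => h.
  by rewrite ltnS mul2n -addnn leq_add // ltnW.
pose h p : {ffun 'I_D -> 'I_(2 * S).+1 * 'I_K} :=
  [ffun i => (Ordinal (cb p i), inord (p.1 i %% K))].
have hI : {in setX Bad [set: 'I_J] &, injective h}.
  move=> [a j] [a' j'] /setXP[/= aBad _] /setXP[/= a'Bad _] hh.
  have cc i : c (a, j) i = c (a', j') i.
    have := congr1 (fun g : {ffun 'I_D -> 'I_(2 * S).+1 * 'I_K} => val (g i).1) hh.
    by rewrite !ffunE.
  have mm i : a i %% K = a' i %% K.
    have := congr1 (fun g : {ffun 'I_D -> 'I_(2 * S).+1 * 'I_K} => val (g i).2) hh.
    by rewrite !ffunE /= !inordK ?ltn_mod.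
  have [i [xF yF long]] := fP a aBad; have [i' [xF' yF' long']] := fP a' a'Bad.
  have fX b z : z \in face (cons_dir (u0 b) (u b)) X -> z \in X by rewrite inE => /andP[].
  have le1 := face_mix_max (ltnW (ltn_ord j)) (ltnW (ltn_ord j')) xF yF
    (fX _ _ xF') (fX _ _ yF').
  have le2 := face_mix_max (ltnW (ltn_ord j')) (ltnW (ltn_ord j)) xF' yF'
    (fX _ _ xF) (fX _ _ yF).
  rewrite !dot_cons in le1 le2.
  have aG : a \in G by move: aBad; rewrite inE => /andP[].
  have aG' : a' \in G by move: a'Bad; rewrite inE => /andP[].
  have s1 := good_separated E0 (good a aG) (good a' aG') le1 le2 cc.
  have s2 := good_separated E0 (good a' aG') (good a aG) le2 le1 (fun i => esym (cc i)).
  have aa : a = a'.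
    apply/ffunP => k; apply: val_inj => /=.
    apply: (modn_inj_near (mm k)); rewrite /K addnS ltnS.
      exact: s1.
    exact: s2.
  subst a'; congr pair; apply: val_inj => /=.
  have := cc i; rewrite /c /= => /addIn; rewrite /Y /= /mix.
  move: long; move: (coords (f a).1 _) (coords (f a).2 _) => p q pq e.
  have step k l : k < l -> l < J ->
      ((J - k) * p + k * q) %/ E < ((J - l) * p + l * q) %/ E.
    move=> kl lJ; have : E + ((J - k) * p + k * q) <= (J - l) * p + l * q.
      have -> : J - k = (J - l) + (l - k) by lia.
      have -> : l * q = k * q + (l - k) * q by rewrite -mulnDl subnKC // ltnW.
      have : (l - k) * (E + p) <= (l - k) * q by rewrite leq_mul2l [E + p]addnC ltnW ?orbT.
      have : 1 * E <= (l - k) * E by rewrite leq_mul2r subn_gt0 kl orbT.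
      rewrite mulnDl mulnDr; lia.
    by move/(leq_div2r E); rewrite divnDl // divnn E0.
  by case: (ltngtP j j') => // lt; have := step _ _ lt (ltn_ord _); rewrite e ltnn.
have -> : #|Bad| * J = #|h @: (setX Bad [set: 'I_J])|.
  by rewrite (card_in_imset hI) cardsX cardsT card_ord.
apply: leq_trans (max_card _) _.
by rewrite card_ffun card_prod !card_ord.
Qed.

(** The constants are chosen in the order B, K, J, B1: the number J of points on
    a long face beats the number of cells and residues of [card_long_faces], so
    that the long faces account for at most S^D / 4 of the S^D points a, of which at least
    S^D / 2 are good.
    The free parameter is g, with E = J g and Q = B1 E; the condition on n makes
    J n at most S E. *)
Lemma direction_family (D : nat) : exists C : nat, forall (g n : nat), 0 < g -> n <= g ^ D.+2 ->
  exists (T : finType) (v : T -> 'I_D.+1 -> nat),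
  [/\ 0 < #|T|, forall a i, v a i <= C * g ^ D &
   forall X : {set {ffun 'I_D.+1 -> 'I_n.+1}},
     #|T| <= 4 * #|[set a | #|face (v a) X| <= 1]|].
Proof.
pose B := 4 * 6 ^ D; pose K := (D * (1 + 2 * B) + 2 * B).+1.
pose J := 4 * (3 * K) ^ D; pose B1 := 4 * 3 ^ D * (4 * (D * B) + 2).
exists ((B1 * J) ^ D) => g n g0 ng.
have J0 : 0 < J by rewrite muln_gt0 expn_gt0.
have B10 : 0 < B1 by rewrite !muln_gt0 expn_gt0 addn_gt0 orbT.
pose E := J * g; pose Q := B1 * E; pose S := Q ^ D.+1.
have E0 : 0 < E by rewrite muln_gt0 J0.
have S0 : 0 < S by rewrite expn_gt0 muln_gt0 B10 E0.
have := @card_good_directions D E E0; rewrite -/B -/B1 -/Q -/S.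
set G := [set _ | _] => cG.
have [w wP] : {w : {ffun 'I_D -> 'I_S} -> nat * ('I_D -> nat) & forall a, a \in G ->
    (w a).1 <= Q ^ D /\ good_direction S B E (fun i => nat_of_ord (a i)) (w a).1 (w a).2}.
  apply: (@choice _ _ (fun a w => a \in G -> w.1 <= Q ^ D /\
    good_direction S B E (fun i => nat_of_ord (a i)) w.1 w.2)) => a.
  have [|n0] := boolP (a \in G); last by exists (0, fun=> 0).
  by rewrite inE => /asboolP[u0 [u [h1 h2]]]; exists (u0, u).
(* Points without a good approximation get the null direction. *)
pose v a := if a \in G then cons_dir (w a).1 (w a).2 else fun=> 0.
have QDE : Q ^ D = (B1 * J) ^ D * g ^ D by rewrite /Q /E mulnA expnMn.
exists {ffun 'I_D -> 'I_S}, v; split.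
- by rewrite card_ffun !card_ord expn_gt0 S0.
- move=> a i; rewrite /v -QDE; case: ifP => // aG.
  have [le0 [_ le1 _ _]] := wP a aG; rewrite /cons_dir; case: unlift => // j.
  exact: leq_trans (le1 j) le0.
- move=> X; pose U := [set a : {ffun 'I_D -> 'I_S} | #|face (v a) X| <= 1].
  rewrite card_ffun !card_ord -[leqRHS]/(4 * #|U|).
  have JnSE : J * n <= S * E.
    rewrite [in X in _ <= X]/E mulnCA leq_mul2l; apply/orP; right.
    apply: leq_trans ng _; rewrite expnSr leq_mul2r; apply/orP; right.
    by rewrite leq_expn2r // /Q /E mulnA leq_pmull // muln_gt0 B10.
  have := @card_long_faces D n S B E J G (fun a => (w a).1) (fun a => (w a).2) X
    E0 JnSE (fun a aG => (wP a aG).2).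
  set Bad := [set a in G | _]; rewrite -/K => cBad.
  have GBU : G \subset Bad :|: U.
    apply/subsetP => a aG; have vE : v a = cons_dir (w a).1 (w a).2 by rewrite /v aG.
    by rewrite !inE vE; move: aG; rewrite inE => -> /=; case: leqP.
  have l1 := leq_trans (subset_leq_card GBU) (leq_card_setU Bad U).1.
  have l2 : 4 * #|Bad| <= S ^ D.
    rewrite -(@leq_pmul2r ((3 * K) ^ D)) ?expn_gt0 // -expnMn.
    have -> : 4 * #|Bad| * (3 * K) ^ D = #|Bad| * J by rewrite /J; ring.
    by apply: leq_trans cBad _; rewrite leq_expn2r // mulnA leq_mul2r; lia.
  lia.
Qed.

(** * Peeling lowers the supporting hyperplanes *)

(** One more than the maximum, so that 0 is the height of the empty set only. *)
Definition height (d n : nat) (v : 'I_d -> nat) (X : {set {ffun 'I_d -> 'I_n.+1}}) : nat :=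
  \max_(x in X) (dot v (coords x)).+1.

(** The unique maximizer is removed, and the others are strictly lower. *)
Lemma height_drop (d n : nat) (v : 'I_d -> nat) (X X' : {set {ffun 'I_d -> 'I_n.+1}}) :
  X != set0 -> X' \subset X -> #|face v X| <= 1 ->
  (forall x, x \in X ->
     (forall y, y \in X -> y != x -> dot v (coords y) < dot v (coords x)) -> x \notin X') ->
  height v X' < height v X.
Proof.
move=> /set0Pn[x0 x0X] sub /card_le1_eqP one ext.
case: (arg_maxnP (fun x => dot v (coords x)) x0X) => x xX xmax.
have max y : y \in X -> dot v (coords y) <= dot v (coords x) by apply: xmax.
have xF : x \in face v X by rewrite inE [x \in X]xX; apply/forall_inP.
have strict y : y \in X -> y != x -> dot v (coords y) < dot v (coords x).
  move=> yX; rewrite ltn_neqAle max // andbT; apply: contraNneq => e.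
  have yF : y \in face v X by rewrite inE yX e; apply/forall_inP.
  by apply/eqP; apply: one.
have nx := ext _ xX strict.
apply: leq_trans (leq_bigmax_cond _ xX); rewrite ltnS.
apply/bigmax_leqP => y yX'; apply: strict; first exact: (subsetP sub).
by apply: contraNneq nx => <-.
Qed.

Lemma height_le (d n H : nat) (v : 'I_d -> nat) (X : {set {ffun 'I_d -> 'I_n.+1}}) :
  (forall i, v i <= H) -> height v X <= (d * (H * n)).+1.
Proof.
move=> vH; apply/bigmax_leqP => x _; rewrite ltnS /dot.
rewrite -[d in X in _ <= X]card_ord -sum_nat_const; apply: leq_sum => i _.
by rewrite leq_mul // -ltnS ltn_ord.
Qed.

Section Ext.
Context (R : realType) (d : nat).
Local Open Scope ring_scope.
Local Open Scope convex_scope.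
Local Open Scope classical_set_scope.
Notation space := (convex_lmodType 'rV[R]_d).

Definition lin (v : 'I_d -> R) (x : 'rV[R]_d) : R := \sum_i v i * x ord0 i.

Lemma conv_coord (a b : space) (t : {i01 R}) i :
  (a <| t |> b : 'rV[R]_d) ord0 i =
    t%:num * (a : 'rV[R]_d) ord0 i + (1 - t%:num) * (b : 'rV[R]_d) ord0 i.
Proof.
have -> : a <| t |> b = t%:num *: (a : 'rV[R]_d) + (1 - t%:num) *: (b : 'rV[R]_d) by [].
by rewrite !mxE.
Qed.

Lemma lin_conv v (a b : space) (t : {i01 R}) :
  lin v (a <| t |> b) = t%:num * lin v a + (1 - t%:num) * lin v b.
Proof.
rewrite /lin !big_distrr -big_split /=; apply: eq_bigr => i _.
by rewrite conv_coord; ring.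
Qed.

Lemma average_lt (t p q m : R) :
  0 < t -> t < 1 -> p <= m -> q <= m -> p < m \/ q < m -> t * p + (1 - t) * q < m.
Proof. by move=> t0 t1 pm qm [pm'|qm']; nra. Qed.

(** The set H of the points that are x or strictly below x is convex, hence
    contains the hull, and x is not inside a nondegenerate segment of H. *)
Lemma unique_max_ext (Y : set space) (v : 'I_d -> R) (x : space) : Y x ->
  (forall y, Y y -> y <> x -> lin v y < lin v x) -> ext Y x.
Proof.
move=> Yx max; pose H : set space := [set y | y = x \/ lin v y < lin v x].
have cH : convex_set H.
  apply/convex_setW => a b /set_mem Ha /set_mem Hb k k0 k1; apply/mem_set.
  have [->|ax] := pselect (a = x); first have [->|bx] := pselect (b = x).
  - by left; rewrite convmm.
  - right; case: Hb => // lt; rewrite lin_conv.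
    by apply: average_lt => //; [exact: ltW | right].
  - right; case: Ha => // lta; rewrite lin_conv.
    apply: average_lt => //; [exact: ltW | | by left].
    by case: Hb => [->|/ltW].
have hull y : convex_hull Y y -> H y.
  apply: (@smallest_sub _ _ _ H cH) => z Yz.
  by have [->|zx] := pselect (z = x); [left | right; exact: max].
split; first exact: sub_gen_smallest.
move=> a b t Ka Kb /andP[t0 t1] xE.
have e : lin v x = t%:num * lin v a + (1 - t%:num) * lin v b by rewrite {1}xE lin_conv.
have wk y : H y -> lin v y <= lin v x by case=> [->|/ltW].
have [Ha Hb] := (hull _ Ka, hull _ Kb).
have := wk _ Ha; have := wk _ Hb => lb la.
case: Ha => [->|lta]; last first.
  by have := average_lt t0 t1 la lb (or_introl lta); rewrite -e ltxx.
case: Hb => [->|ltb] //.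
by have := average_lt t0 t1 la lb (or_intror ltb); rewrite -e ltxx.
Qed.

Lemma midpoint_not_ext (Y : set space) (a b x : space) : Y a -> Y b -> a <> b ->
  a + b = x + x :> 'rV[R]_d -> ~ ext Y x.
Proof.
move=> Ya Yb ab abx [_ xext].
have h (y : space) : Y y -> convex_hull Y y by apply: sub_gen_smallest.
have h0 : 0 <= 2^-1 :> R by rewrite invr_ge0.
have h1 : 2^-1 <= 1 :> R by rewrite invf_le1 // ler1n.
pose half : {i01 R} := Itv01 h0 h1.
have xE : x = a <| half |> b.
  apply/(@rowP R d) => i; rewrite conv_coord /=.
  have := congr1 (fun z : 'rV[R]_d => z ord0 i) abx; rewrite !mxE; lra.
have [|ax bx] := xext a b half (h _ Ya) (h _ Yb) _ xE; last by apply: ab; rewrite ax bx.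
  by rewrite /= invr_gt0 ltr0n invf_lt1 ?ltr1n ?ltr0n.
Qed.

Lemma tau_spec (X : set space) (i : nat) : layer X i = classical_sets.set0 ->
  layer X (tau X) = classical_sets.set0 /\ (tau X <= i)%N.
Proof.
move=> Xi; have ex : exists i, `[< layer X i = classical_sets.set0 >] by exists i; apply/asboolP.
have: exists k, [set i | layer X i = classical_sets.set0 /\
    forall j : nat, layer X j = classical_sets.set0 -> (i <= j)%N] k.
  case: (ex_minnP ex) => k /asboolP k0 kmin; exists k; split=> // j j0.
  by apply: kmin; apply/asboolP.
by move/(xgetPex 0%N) => [h1 h2]; split=> //; apply: h2.
Qed.

Lemma layerSP (X : set space) i x :
  layer X i.+1 x <-> layer X i x /\ ~ ext (layer X i) x.
Proof. by []. Qed.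

Lemma layer_sub (X : set space) i : layer X i `<=` X.
Proof. by elim: i => // i IH x /layerSP[/IH]. Qed.

Definition emb (n : nat) (x : {ffun 'I_d -> 'I_n.+1}) : space := \row_i (x i)%:R.

Lemma lin_emb n (v : 'I_d -> nat) (x : {ffun 'I_d -> 'I_n.+1}) :
  lin (fun i => (v i)%:R) (emb x) = (dot v (coords x))%:R.
Proof. by rewrite /dot natr_sum; apply: eq_bigr => i _; rewrite mxE natrM. Qed.

Lemma grid_emb n (y : space) : grid R d n y -> exists x : {ffun 'I_d -> 'I_n.+1}, y = emb x.
Proof.
move=> gy; have ex i : exists k : nat, (k < n.+1)%N /\ (y : 'rV[R]_d) ord0 i = k%:R.
  by have [k /andP[_ kn] e] := gy i; exists k.
have [k kP] := choice ex; have kn i : (k i < n.+1)%N by case: (kP i).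
exists [ffun i => Ordinal (kn i)]; apply/rowP => i; rewrite mxE ffunE /=.
by case: (kP i).
Qed.

(** Each step lowers the height of at least a quarter of the directions, and a
    nonempty layer keeps every height positive. *)
Lemma layer_empty (n H : nat) (T : finType) (v : T -> 'I_d -> nat) :
  (0 < #|T|)%N -> (forall a i, v a i <= H)%N ->
  (forall X : {set {ffun 'I_d -> 'I_n.+1}},
     #|T| <= 4 * #|[set a | #|face (v a) X| <= 1]%SET|)%N ->
  layer (grid R d n) (4 * (d * (H * n)).+1) = classical_sets.set0.
Proof.
move=> T0 vH many; set M := (d * (H * n)).+1; set L := layer _.
pose X i : {set {ffun 'I_d -> 'I_n.+1}} := [set x | `[< L i (emb x) >]]%SET.
have XP i x : reflect (L i (emb x)) (x \in X i).
  by rewrite in_set; apply: asboolP.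
have step i : X i != set0 ->
    (4 * \sum_a height (v a) (X i.+1) + #|T| <= 4 * \sum_a height (v a) (X i))%N.
  move=> Xi0.
  have sub : X i.+1 \subset X i.
    by apply/subsetP => x /XP/layerSP[Lx _]; apply/XP.
  have le1 := many (X i).
  have le2 : (\sum_a height (v a) (X i.+1) +
      #|[set a | (#|face (v a) (X i)| <= 1)%N]%SET| <= \sum_a height (v a) (X i))%N.
    rewrite -sum1_card [X in (_ + X)%N]big_mkcond -big_split /=.
    apply: leq_sum => a _; rewrite in_set; have [one|_] := leqP #|face (v a) (X i)| 1; last first.
      rewrite addn0; apply/bigmax_leqP => x xX; apply: leq_bigmax_cond.
      exact: (subsetP sub).
    rewrite addn1; apply: height_drop => // x /XP Lx max.
    apply/XP => /layerSP[_]; apply.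
    apply: (unique_max_ext (v := fun i => (v a i)%:R)) => // y Ly yx.
    have [z zE] := grid_emb (layer_sub Ly); subst y.
    rewrite !lin_emb ltr_nat; apply: max; first exact/XP.
    by apply/eqP => e; apply: yx; rewrite e.
  by apply: leq_trans (leq_mul (leqnn 4) le2); rewrite mulnDr leq_add2l.
have bound i : X i != set0 ->
    (4 * \sum_a height (v a) (X i) + i * #|T| <= 4 * (#|T| * M))%N.
  elim: i => [_|i IH Xi]; last first.
    have Xi' : X i != set0.
      have /set0Pn[x /XP/layerSP[Lx _]] := Xi.
      by apply/set0Pn; exists x; apply/XP.
    by have := IH Xi'; have := step _ Xi'; lia.
  rewrite mul0n addn0 leq_mul2l -sum_nat_const /=.
  by apply: leq_sum => a _; apply: height_le.
rewrite -classical_sets.subset0 => y Ly.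
have [x xE] := grid_emb (layer_sub Ly); subst y.
have xX : x \in X (4 * M)%N by apply/XP.
have X0 : X (4 * M)%N != set0 by apply/set0Pn; exists x.
have : (#|T| <= \sum_a height (v a) (X (4 * M)))%N.
  rewrite -sum1_card; apply: leq_sum => a _.
  exact: leq_trans (leq_bigmax_cond _ xX).
have := bound _ X0; rewrite -mulnA [(M * _)%N]mulnC; lia.
Qed.
End Ext.

Local Open Scope ring_scope.

(** * Lattice points of a shrinking ball survive *)

(** The scalar products of z with the (q + 1)^d points of [0, q]^d spread over an
    interval of length 2 d n q <= 2 d q^(d+2), which at most q^d intervals of
    length 4 d q^2 cover; two points share one of these, and w is their
    difference. *)
Lemma short_flat_vector (d q n : nat) (z : 'I_d -> int) :
  (0 < d)%N -> (0 < q)%N -> (n <= q ^ d.+1)%N -> (forall i, `|z i| <= n%:Z) ->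
  exists w : 'I_d -> int, (exists i, w i != 0) /\
    \sum_i w i ^+ 2 + 2 * `|\sum_i z i * w i| <= (9 * d * q ^ 2)%N%:Z.
Proof.
move=> d0 q0 nq zn; set W := (4 * d * q ^ 2)%N.
have W0 : (0 < W)%N by rewrite !muln_gt0 d0 q0.
pose s (a : {ffun 'I_d -> 'I_q.+1}) : int := \sum_i z i * (a i)%:Z.
pose M := (d * (n * q))%N.
have sM a : `|s a| <= M%:Z.
  apply: le_trans (ler_norm_sum _ _ _) _.
  have -> : M%:Z = \sum_(i < d) (n%:Z * q%:Z).
    by rewrite sumr_const card_ord -mulr_natr natz /M !PoszM; ring.
  apply: ler_sum => i _; rewrite normrM ler_pM //.
  by have := ltn_ord (a i); lia.
pose f a := ((absz (s a + M%:Z)%R) %/ W)%N.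
have [||a [b [ab fab]]] := @pigeonhole _ (q ^ d)%N f.
- move=> a; rewrite /f ltn_divLR //.
  have : (2 * M < q ^ d * W)%N.
    rewrite /M /W; have p : (0 < q ^ d)%N by rewrite expn_gt0 q0.
    have h1 : (2 * (d * (n * q)) <= 2 * (d * (q ^ d.+1 * q)))%N by rewrite !leq_mul.
    apply: leq_ltn_trans h1 _; rewrite expnS.
    have -> : (2 * (d * (q * q ^ d * q)) = 2 * (q ^ d * (d * q ^ 2)))%N by ring.
    have -> : (q ^ d * (4 * d * q ^ 2) = 4 * (q ^ d * (d * q ^ 2)))%N by ring.
    by rewrite ltn_pmul2r // !muln_gt0 p d0 q0.
  by have := sM a; lia.
- by rewrite card_ffun !card_ord ltn_exp2r.
exists (fun i => (a i)%:Z - (b i)%:Z); split.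
  apply: contrapT => h; case/eqP: ab; apply/ffunP => i; apply: val_inj => /=.
  apply/eqP; apply: contrapT => /negP ne.
  by apply: h; exists i; rewrite subr_eq0 eqz_nat.
have sq : \sum_i ((a i)%:Z - (b i)%:Z) ^+ 2 <= (d * q ^ 2)%N%:Z.
  have -> : (d * q ^ 2)%N%:Z = \sum_(i < d) q%:Z ^+ 2.
    by rewrite sumr_const card_ord -mulr_natr natz PoszM mulrC -[(q ^ 2)%N]/(q * q)%N PoszM expr2.
  apply: ler_sum => i _; have := ltn_ord (a i); have := ltn_ord (b i).
  move: (nat_of_ord (a i)) (nat_of_ord (b i)) => k l; nia.
have lin : \sum_i z i * ((a i)%:Z - (b i)%:Z) = s a - s b.
  by rewrite /s -sumrB; apply: eq_bigr => i _; ring.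
have diff : `|s a - s b| <= W%:Z.
  have := sM a; have := sM b; have := divn_eq (absz (s a + M%:Z)%R) W.
  have := divn_eq (absz (s b + M%:Z)%R) W; rewrite -/(f a) -/(f b) fab.
  have := ltn_pmod (absz (s a + M%:Z)%R) W0; have := ltn_pmod (absz (s b + M%:Z)%R) W0.
  lia.
rewrite lin; move: sq diff; rewrite /W; lia.
Qed.

Section LowerBound.
Context (R : realType) (d n q N : nat).
Hypotheses (d0 : (0 < d)%N) (q0 : (0 < q)%N) (nq : (n <= q ^ d.+1)%N)
  (Nn : (N.*2 < n)%N).

(** The centre of the ball has all its coordinates equal to N + 1. *)
Definition shifted (z : 'I_d -> int) : convex_lmodType 'rV[R]_d :=
  \row_i (N.+1%:Z + z i)%:~R.

(** The bound on w in [short_flat_vector] bounds by 9 d q^2 the growth of the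
    squared norm from z to z + w and to z - w. *)
Lemma layer_ball (i : nat) (z : 'I_d -> int) :
  \sum_j z j ^+ 2 + (i * (9 * d * q ^ 2))%N%:Z <= (N ^ 2)%N%:Z ->
  layer (grid R d n) i (shifted z).
Proof.
set g := (9 * d * q ^ 2)%N.
have coord (y : 'I_d -> int) : \sum_j y j ^+ 2 <= (N ^ 2)%N%:Z -> forall j, `|y j| <= N%:Z.
  move=> le j; rewrite (bigD1 j) //= in le.
  have : 0 <= \sum_(k | k != j) y k ^+ 2 by apply: sumr_ge0 => k _; apply: sqr_ge0.
  move: le; move: (\sum_(k | _) _) (y j) => s t; nia.
elim: i z => [z|i IH z] zN.
  move=> j; have := coord z; rewrite mul0n addr0 in zN => /(_ zN j) zj.
  exists (absz (N.+1%:Z + z j)%R); first by lia.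
  rewrite mxE -[X in X%:~R = _](_ : (absz (N.+1%:Z + z j)%R)%:Z = _) //; lia.
have zN' : \sum_j z j ^+ 2 + (i * g)%N%:Z <= (N ^ 2)%N%:Z by lia.
apply/layerSP; split; first exact: IH.
have zn j : `|z j| <= n%:Z.
  have : `|z j| <= N%:Z by apply: coord; lia.
  lia.
have [w [[j wj] wle]] := short_flat_vector d0 q0 nq zn.
have move_in (e : int) : `|e| = 1 ->
    layer (grid R d n) i (shifted (fun j => z j + e * w j)).
  move=> e1; apply: IH.
  have -> : \sum_j (z j + e * w j) ^+ 2 =
      \sum_j z j ^+ 2 + \sum_j w j ^+ 2 + 2 * (e * \sum_j z j * w j).
    rewrite !big_distrr -!big_split /=; apply: eq_bigr => k _.
    have e2 : e * e = 1 by have [->|->] : e = 1 \/ e = -1 by lia.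
    have -> : (z k + e * w k) ^+ 2 =
        z k ^+ 2 + (e * e) * w k ^+ 2 + 2 * (e * (z k * w k)) by ring.
    by rewrite e2; ring.
  have : e * (\sum_j z j * w j) <= `|\sum_j z j * w j|.
    by apply: le_trans (ler_norm _) _; rewrite normrM e1 mul1r.
  rewrite -/g in wle; move: wle zN; lia.
apply: (midpoint_not_ext (move_in 1 _) (move_in (-1) _)) => //.
  move/rowP/(_ j); rewrite !mxE => /eqP; rewrite eqr_int; move: wj; lia.
apply/rowP => k; rewrite !mxE -!rmorphD /=; congr (_%:~R); ring.
Qed.

Lemma layer_lt_tau (i : nat) : layer (grid R d n) (tau (grid R d n)) = classical_sets.set0 ->
  (i * (9 * d * q ^ 2) <= N ^ 2)%N -> (i < tau (grid R d n))%N.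
Proof.
move=> empty iN; rewrite ltnNge; apply/negP => ti.
have : layer (grid R d n) (tau (grid R d n)) (shifted (fun=> 0)).
  apply: layer_ball; rewrite big1 => [|j _]; last by rewrite expr0n.
  rewrite add0r lez_nat; apply: leq_trans iN; by rewrite leq_mul2r ti orbT.
by rewrite empty.
Qed.

End LowerBound.

(** * The order of magnitude of the layer number *)

Lemma root_ceil (d n : nat) : (1 < n)%N ->
  exists q, [/\ (1 < q)%N, (n <= q ^ d.+1)%N & (q.-1 ^ d.+1 <= n)%N].
Proof.
move=> n1; have ex : exists q, (n <= q ^ d.+1)%N.
  by exists n; rewrite expnS leq_pmulr // expn_gt0 ltnW.
case: (ex_minnP ex) => q qn qmin; exists q; split=> //.
  by case: q qn {qmin} => [|[|q]] //; rewrite ?exp0n ?exp1n //; lia.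
rewrite leqNgt; apply/negP => /ltnW/qmin.
by case: q qn {qmin} => [|q] /=; rewrite ?exp0n //; lia.
Qed.

Theorem theorem1 (R : realType) (d : nat) (hd : (1 <= d)%N) :
  exists (c C : R) (N : nat),
    [/\ 0 < c, 0 < C, (1 <= N)%N &
      forall n : nat, (N <= n)%N ->
        c * n%:R `^ ((2 * d)%N%:R / d.+1%:R) <= (tau (grid R d n))%:R /\
        (tau (grid R d n))%:R <= C * n%:R `^ ((2 * d)%N%:R / d.+1%:R)].
Proof.
have [D dE] : exists D, d = D.+1 by exists d.-1; rewrite prednK.
have [C family] := direction_family D; rewrite -dE in family.
exists (576 * d)%N%:R^-1, (4 * (d * C).+1 * 2 ^ (2 * d))%N%:R, 4%N.
split.
- by rewrite invr_gt0 ltr0n muln_gt0.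
- by rewrite ltr0n !muln_gt0 expn_gt0.
- by [].
move=> n n4; have [q [q1 nq qn]] := @root_ceil d n (ltnW (ltnW n4)).
have q0 : (0 < q)%N by lia.
set p : R := n%:R `^ d.+1%:R^-1.
have p0 : 0 < p by rewrite powR_gt0 // ltr0n; lia.
have pn : p ^+ d.+1 = n%:R.
  by rewrite -powR_mulrn ?(ltW p0) // -powRrM mulVf ?pnatr_eq0 // powRr1.
have -> : n%:R `^ ((2 * d)%N%:R / d.+1%:R) = p ^+ (2 * d).
  by rewrite mulrC powRrM powR_mulrn // ltW.
have q2p : q%:R <= 2 * p.
  have qp : q.-1%:R <= p.
    by rewrite -(@ler_pXn2r _ d.+1) ?nnegrE ?(ltW p0) // pn -natrX ler_nat.
  apply: le_trans (_ : (2 * q.-1)%:R <= _); first by rewrite ler_nat; lia.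
  by rewrite natrM ler_pM2l.
have [T [v [T0 vC many]]] := family q n q0 nq.
have [empty tau_le] := tau_spec (layer_empty R T0 vC many).
split; last first.
  apply: le_trans (_ : (4 * (d * C).+1 * q ^ (2 * d))%N%:R <= _).
    rewrite ler_nat; apply: leq_trans tau_le _; rewrite -[leqRHS]mulnA leq_mul2l /=.
    have : (q ^ D * n <= q ^ (2 * d))%N.
      have -> : (2 * d = D + d.+1)%N by lia.
      by rewrite expnD leq_mul2l nq orbT.
    have : (0 < q ^ (2 * d))%N by rewrite expn_gt0 q0.
    move: (q ^ D)%N (q ^ (2 * d))%N => x y y0 xny.
    have : (d * (C * x * n) <= d * (C * y))%N by rewrite leq_mul2l -mulnA leq_mul2l xny !orbT.
    by rewrite mulSn mulnA; lia.
  rewrite !natrM -!mulrA !ler_wpM2l // !natrX -exprMn.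
  by apply: lerXn2r => //; rewrite nnegrE // mulr_ge0 // ltW.
(* The ball of radius N >= n / 4 fits in the grid. *)
set N := (n.-1)./2.
have Nn : (N.*2 < n)%N by rewrite /N; lia.
have n4N : (n <= 4 * N)%N by rewrite /N; lia.
set k := (N ^ 2 %/ (9 * d * q ^ 2))%N.
have g0 : (0 < 9 * d * q ^ 2)%N by rewrite !muln_gt0 hd q0.
have kt : (k < tau (grid R d n))%N.
  exact: (layer_lt_tau hd q0 nq Nn empty (leq_divM _ _)).
have n2 : (n ^ 2 <= 144 * d * q ^ 2 * tau (grid R d n))%N.
  have : (N ^ 2 < k.+1 * (9 * d * q ^ 2))%N by rewrite -ltn_divLR.
  have : (n ^ 2 <= 16 * N ^ 2)%N by rewrite -[16%N]/(4 ^ 2)%N -expnMn leq_exp2r.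
  have := leq_mul kt (leqnn (9 * d * q ^ 2)); lia.
rewrite ler_pdivrMl ?ltr0n ?muln_gt0 //.
rewrite -(@ler_pM2l _ (p ^+ 2)) ?exprn_gt0 // -exprD.
have -> : (2 + 2 * d = d.+1 * 2)%N by lia.
rewrite exprM pn -natrX.
apply: le_trans (_ : (144 * d * q ^ 2 * tau (grid R d n))%N%:R <= _).
  by rewrite ler_nat.
rewrite !natrM [leRHS]mulrA ler_wpM2r //.
have scale (x y e : R) : 0 <= e -> x ^+ 2 <= (2 * y) ^+ 2 ->
  144 * e * (x * x) <= y ^+ 2 * (576 * e) by nra.
by apply: scale => //; apply: lerXn2r => //; rewrite nnegrE // mulr_ge0 // ltW.
Qed.
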